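(* Let $K_+,S,D,K_-$ be the matrices and $\boldsymbol f_+,\boldsymbol f_-$ the load vectors of the discrete coupled problem described in the context, whose algebraic form is $$\begin{bmatrix}K_+&S\\ D&K_-\end{bmatrix}\begin{bmatrix}\boldsymbol T_+^h\\ \boldsymbol T_-^h\end{bmatrix}=\begin{bmatrix}\boldsymbol f_+\\ \boldsymbol f_-\end{bmatrix}.\qquad( * )$$ Given an initial guess $\boldsymbol T_+^{h,0}$, define for $k\ge0$ the (unrelaxed) iteration $$K_-\boldsymbol T_-^{h,k+1}=\boldsymbol f_--D\,\boldsymbol T_+^{h,k},\qquad K_+\boldsymbol T_+^{h,k+1}=\boldsymbol f_+-S\,\boldsymbol T_-^{h,k+1}.$$ Then for every $k\ge1$, $$\boldsymbol T_+^{h,k}=\left[\sum_{j=0}^{k-1}\left(K_+^{-1}SK_-^{-1}D\right)^j\right]K_+^{-1}\left(\boldsymbol f_+-SK_-^{-1}\boldsymbol f_-\right)+\left(K_+^{-1}SK_-^{-1}D\right)^k\boldsymbol T_+^{h,0}.$$ Further, if the spectral radius satisfies $\rho\left(K_+^{-1}SK_-^{-1}D\right)<1$, then the iteration $(\boldsymbol T_+^{h,k},\boldsymbol T_-^{h,k})$ converges, as $k\to\infty$, to the solution $(\boldsymbol T_+^h,\boldsymbol T_-^h)$ of $( * )$.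
   Context: **Setting.** $\Omega_+\subset\mathbb R^d$ ($d=2,3$) is a bounded Lipschitz domain and $\Omega_-\subset\Omega_+$ a Lipschitz subdomain; $\Gamma_D\subseteq\partial\Omega_+$ is the Dirichlet boundary (of positive surface measure), $\Gamma_N\subset\partial\Omega_+$ the Neumann boundary; $\gamma_i=\partial\Omega_-\setminus\partial\Omega_+$ (of positive surface measure) is the interface; $\mathbf n$ is the unit normal pointing outward from $\Omega_-$. $\kappa_+,\kappa_->0$ are constants and $\alpha>0$ is a penalization parameter. **Discretization.** $\mathcal T_+$, $\mathcal T_-$ are meshes of $\Omega_+$, $\Omega_-$; $\mathcal E_i$ is the partition of $\gamma_i$ into edges/faces induced by $\mathcal T_-$. $X_{\mathcal T_+}\subset H^1(\Omega_+)$ and $X_{\mathcal T_-}\subset H^1(\Omega_-)$ are the corresponding finite-dimensional (continuous piecewise polynomial) finite element spaces. Let $\{\varphi_j\}$ be a basis of $\{v\in X_{\mathcal T_+}: v=0\text{ on }\Gamma_D\}$ and $\{\psi_j\}$ a basis of $\{w\in X_{\mathcal T_-}: w=0\text{ on }\Gamma_D\cap\partial\Omega_-\}$. The coefficient vectors of the discrete global and local unknowns $T_+^h$ and $T_-^h$ (after lifting the Dirichlet data) are $\boldsymbol T_+^h$ and $\boldsymbol T_-^h$. **Matrices.** $$(K_+)_{ij}=\int_{\Omega_+}\kappa_+\nabla\varphi_j\cdot\nabla\varphi_i,\qquad S_{ij}=-\sum_{e\in\mathcal E_i}\int_e(\kappa_+-\kappa_-)(\nabla\psi_j\cdot\mathbf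 n)\,\varphi_i,$$ $$D_{ij}=-\alpha\int_{\gamma_i}\varphi_j\,\psi_i,\qquad (K_-)_{ij}=\int_{\Omega_-}\kappa_-\nabla\psi_j\cdot\nabla\psi_i+\alpha\int_{\gamma_i}\psi_j\,\psi_i.$$ $K_+$ and $K_-$ are square and invertible (of generally different sizes). The vectors $\boldsymbol f_+,\boldsymbol f_-$ collect the contributions of the source terms, Neumann data and lifted Dirichlet data. *)

(* Defs.v *)
From HB Require Import structures.
From mathcomp Require Import all_boot all_order all_algebra.
From mathcomp Require Import all_classical all_reals all_analysis.
From mathcomp Require Import complex.

Set Implicit Arguments.
Unset Strict Implicit.
Unset Printing Implicit Defensive.

Import Order.TTheory GRing.Theory Num.Theory.
Import numFieldNormedType.Exports.

Local Open Scope classical_set_scope.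
Local Open Scope ring_scope.

(* R^d is 'rV[R]_d, on which the library norm `|x| is the sup norm; Euclidean
   lengths are given by enorm. *)

Section Euclidean.
Context {R : realType} {d : nat}.
Implicit Types (x y : 'rV[R]_d) (A : set 'rV[R]_d).

Definition dot x y : R := \sum_(i < d) x ord0 i * y ord0 i.

Definition enorm x : R := Num.sqrt (dot x x).

(* -oo on the empty set *)
Definition ediam A : \bar R :=
  ereal_sup [set (enorm (x - y))%:E | x in A & y in A].

Definition bdry A : set 'rV[R]_d := closure A `\` A°.

Definition grad (f : 'rV[R]_d -> R) x : 'rV[R]_d :=
  \row_(i < d) 'D_(delta_mx 0 i) f x.

End Euclidean.

Definition powerset_space (T : pointedType) : Type := T.
HB.instance Definition _ (T : pointedType) := Pointed.on (powerset_space T).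
HB.instance Definition _ (T : pointedType) :=
  @isMeasurable.Build default_measure_display (powerset_space T)
    (@discrete_measurable T) (@discrete_measurable0 T)
    (@discrete_measurableC T) (@discrete_measurableU T).

Section CoverMeasure.
Context {R : realType} {T : pointedType}.

Definition cover_measure (tau : set T -> \bar R) (X : set T) : \bar R :=
  ereal_inf [set (\sum_(k <oo) tau (F k))%E |
               F in [set F : (set T)^nat | X `<=` \bigcup_k F k]].

Lemma cover_measureE (tau : set T -> \bar R) :
  cover_measure tau = mu_ext (tau : set (powerset_space T) -> \bar R).
Proof.
apply/funext => X; congr ereal_inf; apply/seteqP.
by split => _ [F XF <-]; exists F => //; case: XF.
Qed.

Variable tau : set T -> \bar R.
Hypotheses (tau0 : tau set0 = 0%E) (tau_ge0 : forall A, (0 <= tau A)%E).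

Lemma cover_measure0 : cover_measure tau set0 = 0%E.
Proof. by rewrite cover_measureE mu_ext0. Qed.

Lemma cover_measure_ge0 A : (0 <= cover_measure tau A)%E.
Proof. by rewrite cover_measureE mu_ext_ge0. Qed.

Lemma le_cover_measure :
  {homo cover_measure tau : A B / A `<=` B >-> (A <= B)%E}.
Proof.
by move=> A B AB; rewrite cover_measureE;
  exact: (@le_mu_ext _ (powerset_space T) R tau A B AB).
Qed.

Lemma cover_measure_sigma_subadditive : sigma_subadditive (cover_measure tau).
Proof.
rewrite cover_measureE => F.
exact: (@mu_ext_sigma_subadditive _ (powerset_space T) R tau tau_ge0 F).
Qed.

End CoverMeasure.

Section Lebesgue.
Context (R : realType) (d : nat).

(* least volume of a closed box containing A; the empty set is singled out
   only because of the degenerate case d = 0 *)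
Definition box_cost (A : set 'rV[R]_d) : \bar R :=
  if A == set0 then 0%E else
  ereal_inf [set (\prod_(i < d) (ab.2 ord0 i - ab.1 ord0 i))%:E |
    ab in [set ab : 'rV[R]_d * 'rV[R]_d |
      (forall i, ab.1 ord0 i <= ab.2 ord0 i) /\
      A `<=` [set x | forall i, ab.1 ord0 i <= x ord0 i <= ab.2 ord0 i]]].

Definition lebesgue_outer : set 'rV[R]_d -> \bar R := cover_measure box_cost.

Lemma box_cost0 : box_cost set0 = 0%E.
Proof. by rewrite /box_cost eqxx. Qed.

Lemma box_cost_ge0 A : (0 <= box_cost A)%E.
Proof.
rewrite /box_cost; case: ifP => // _.
apply: le_ereal_inf_tmp => _ [ab [ab_le _] <-].
by rewrite lee_fin prodr_ge0// => i _; rewrite subr_ge0.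
Qed.

HB.instance Definition _ := isOuterMeasure.Build R 'rV[R]_d lebesgue_outer
  (cover_measure0 box_cost0 box_cost_ge0) (cover_measure_ge0 box_cost_ge0)
  (@le_cover_measure _ _ box_cost)
  (cover_measure_sigma_subadditive box_cost_ge0).

Definition lebesgue_om : {outer_measure set 'rV[R]_d -> \bar R} :=
  lebesgue_outer.

(* d-dimensional Lebesgue measure, on its Caratheodory sigma-algebra *)
Definition lebesgue_vol :
    {measure set (caratheodory_type lebesgue_om) -> \bar R} := lebesgue_om.

End Lebesgue.

Section Hausdorff.
Context (R : realType) (d : nat) (s : nat).

(* volume of the unit ball of R^n *)
Fixpoint ball_volume (n : nat) : R :=
  match n with
  | 0%N => 1
  | 1%N => 2
  | n'.+2 => 2 * pi / n'.+2%:R * ball_volume n'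
  end.

(* The factor ball_volume s / 2 ^ s makes the s-dimensional Hausdorff measure
   agree with length (s = 1) and area (s = 2). *)
Definition hausdorff_cost (delta : R) (A : set 'rV[R]_d) : \bar R :=
  if A == set0 then 0%E
  else if (ediam A <= delta%:E)%E
       then (ball_volume s / 2 ^+ s * fine (ediam A) ^+ s)%:E
       else +oo%E.

Definition hausdorff_outer (A : set 'rV[R]_d) : \bar R :=
  ereal_sup [set cover_measure (hausdorff_cost delta) A |
               delta in [set delta | 0 < delta]].

Lemma ball_volume_ge0 n : 0 <= ball_volume n.
Proof.
have [k] := ubnP n; elim: k n => // k IHk [|[|n]] //= /ltnW nk.
by rewrite mulr_ge0 ?IHk// divr_ge0 ?mulr_ge0 ?pi_ge0 ?ler0n.
Qed.

Lemma ediam_ge0 (A : set 'rV[R]_d) : A != set0 -> (0 <= ediam A)%E.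
Proof.
move=> /set0P[x Ax]; apply: ereal_sup_ubound.
exists x => //; exists x => //; congr (_%:E).
rewrite subrr /enorm (_ : dot _ _ = 0) ?sqrtr0// /dot.
by rewrite big1// => i _; rewrite mxE mul0r.
Qed.

Lemma hausdorff_cost0 delta : hausdorff_cost delta set0 = 0%E.
Proof. by rewrite /hausdorff_cost eqxx. Qed.

Lemma hausdorff_cost_ge0 delta A : (0 <= hausdorff_cost delta A)%E.
Proof.
rewrite /hausdorff_cost; case: ifPn => // A0; case: ifP => // _.
rewrite lee_fin mulr_ge0 ?divr_ge0 ?ball_volume_ge0 ?exprn_ge0//.
by rewrite fine_ge0// ediam_ge0.
Qed.

Let H_ delta := cover_measure (hausdorff_cost delta).

Let le_H_ delta A : 0 < delta -> (H_ delta A <= hausdorff_outer A)%E.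
Proof. by move=> delta0; apply: ereal_sup_ubound; exists delta. Qed.

Lemma hausdorff_outer0 : hausdorff_outer set0 = 0%E.
Proof.
have H0 delta : H_ delta set0 = 0%E.
  by apply: cover_measure0; [exact: hausdorff_cost0|exact: hausdorff_cost_ge0].
apply/eqP; rewrite eq_le; apply/andP; split.
  by apply: ge_ereal_sup => _ [delta _ <-]; rewrite -/(H_ _) H0.
by rewrite -(H0 1) le_H_.
Qed.

Lemma hausdorff_outer_ge0 A : (0 <= hausdorff_outer A)%E.
Proof.
by apply: le_trans (@le_H_ 1 A _) => //; apply: cover_measure_ge0;
  exact: hausdorff_cost_ge0.
Qed.

Lemma le_hausdorff_outer :
  {homo hausdorff_outer : A B / A `<=` B >-> (A <= B)%E}.
Proof.
move=> A B AB; apply: ge_ereal_sup => _ [delta delta0 <-].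
by apply: le_trans (le_H_ B delta0); exact: le_cover_measure.
Qed.

Lemma hausdorff_outer_sigma_subadditive : sigma_subadditive hausdorff_outer.
Proof.
move=> F; apply: ge_ereal_sup => _ [delta delta0 <-].
apply: le_trans (cover_measure_sigma_subadditive
  (hausdorff_cost_ge0 delta) F) _.
apply: lee_nneseries => [i _ _|i _].
  by apply: cover_measure_ge0; exact: hausdorff_cost_ge0.
exact: le_H_ (F i) delta0.
Qed.

HB.instance Definition _ := isOuterMeasure.Build R 'rV[R]_d hausdorff_outer
  hausdorff_outer0 hausdorff_outer_ge0 le_hausdorff_outer
  hausdorff_outer_sigma_subadditive.

Definition hausdorff_om : {outer_measure set 'rV[R]_d -> \bar R} :=
  hausdorff_outer.

Definition hausdorff_measure :
    {measure set (caratheodory_type hausdorff_om) -> \bar R} := hausdorff_om.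

End Hausdorff.

Section Integrals.
Context {R : realType} {d : nat}.

Definition surface_measure :
    {measure set (caratheodory_type (@hausdorff_om R d d.-1)) -> \bar R} :=
  @hausdorff_measure R d d.-1.

Definition vol_integral (D : set 'rV[R]_d) (f : 'rV[R]_d -> R) : R :=
  Rintegral (@lebesgue_vol R d) D f.

Definition surf_integral (D : set 'rV[R]_d) (f : 'rV[R]_d -> R) : R :=
  Rintegral surface_measure D f.

End Integrals.

Section Domains.
Context {R : realType} {d : nat}.
Implicit Types (Omega : set 'rV[R]_d) (x : 'rV[R]_d).

(* Near each boundary point p, in the orthogonal decomposition p + y + t *: e
   with e a unit vector and y orthogonal to e, Omega is the strict epigraph of
   a Lipschitz function of y (only the values of g on the hyperplane
   orthogonal to e matter). *)
Definition lipschitz_boundary Omega : Prop :=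
  forall p, bdry Omega p ->
  exists (e : 'rV[R]_d) (g : 'rV[R]_d -> R) (r h : R),
    [/\ enorm e = 1, lipschitz g, 0 < r, 0 < h &
      forall (y : 'rV[R]_d) (t : R), dot y e = 0 -> enorm y < r -> `|t| < h ->
        (Omega (p + y + t *: e) <-> g y < t) /\
        (bdry Omega (p + y + t *: e) <-> t = g y)].

Definition lipschitz_domain Omega : Prop :=
  [/\ open Omega, connected Omega, Omega !=set0, bounded_set Omega &
      lipschitz_boundary Omega].

(* The half-space {y | (y - x).v < 0} approximates Omega to first order at x;
   this determines v. *)
Definition outward_unit_normal Omega x (v : 'rV[R]_d) : Prop :=
  enorm v = 1 /\
  forall eps : R, 0 < eps -> \forall y \near x,
    (dot (y - x) v < - (eps * enorm (y - x)) -> Omega y) /\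
    (eps * enorm (y - x) < dot (y - x) v -> ~ closure Omega y).

End Domains.

Section Meshes.
Context {R : realType} {d : nat}.
Implicit Types (Omega K F : set 'rV[R]_d) (T : set (set 'rV[R]_d)).

Definition convex_hull (n : nat) (v : 'I_n -> 'rV[R]_d) : set 'rV[R]_d :=
  [set x | exists c : 'I_n -> R, [/\ forall i, 0 <= c i,
     \sum_(i < n) c i = 1 & x = \sum_(i < n) c i *: v i]].

Definition polytope K : Prop :=
  exists (n : nat) (v : 'I_n -> 'rV[R]_d), K = convex_hull v.

(* a = 0 gives the improper faces K and set0 *)
Definition face_by (a : 'rV[R]_d) (b : R) F K : Prop :=
  (forall x, K x -> dot a x <= b) /\ F = K `&` [set x | dot a x = b].

Definition face F K : Prop := exists a b, face_by a b F K.

(* edges of K if d = 2, two-dimensional faces of K if d = 3 *)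
Definition facet F K : Prop :=
  exists a b, [/\ a != 0, face_by a b F K & (0 < surface_measure F)%E].

Definition is_mesh Omega T : Prop :=
  [/\ finite_set T,
      forall K, T K -> polytope K /\ K° !=set0,
      \bigcup_(K in T) K = closure Omega &
      forall K K', T K -> T K' -> K <> K' ->
        [/\ K° `&` K'° = set0, face (K `&` K') K & face (K `&` K') K']].

(* The partition of gamma induced by the facets of T lying on the boundary of
   Omega; facets that meet gamma only in a null set are discarded. *)
Definition induced_partition Omega T (gamma : set 'rV[R]_d) :
    set (set 'rV[R]_d) :=
  [set E | exists K F, [/\ T K, facet F K, F `<=` bdry Omega,
     E = F `&` gamma & (0 < surface_measure E)%E]].

End Meshes.

Section FiniteElements.
Context {R : realType} {d : nat}.
Implicit Types (Omega : set 'rV[R]_d) (T : set (set 'rV[R]_d)).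

(* polynomial function with all partial degrees at most p *)
Definition polynomial_of_degree (p : nat) (q : 'rV[R]_d -> R) : Prop :=
  exists c : {ffun 'I_d -> 'I_p.+1} -> R, forall x,
    q x = \sum_(a : {ffun 'I_d -> 'I_p.+1}) c a * \prod_(i < d) x ord0 i ^+ a i.

Definition local_polynomial_space (V : set ('rV[R]_d -> R)) : Prop :=
  [/\ V (fun=> 0),
      forall (a : R) u v, V u -> V v -> V (fun x => a * u x + v x) &
      exists p : nat, forall q, V q -> polynomial_of_degree p q].

(* Continuous functions that coincide on each element K with a member of the
   local space P K.  Functions on closure Omega are represented by total
   functions whose values elsewhere are irrelevant. *)
Definition fe_space Omega T (P : set 'rV[R]_d -> set ('rV[R]_d -> R)) :
    set ('rV[R]_d -> R) :=
  [set v | {within closure Omega, continuous v} /\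
     forall K, T K -> exists2 q, P K q & forall x, K x -> v x = q x].

Definition basis_on (A : set 'rV[R]_d) (V : set ('rV[R]_d -> R)) (n : nat)
    (b : 'I_n -> 'rV[R]_d -> R) : Prop :=
  [/\ forall j, V (b j),
      forall v, V v -> exists c : 'I_n -> R,
        forall x, A x -> v x = \sum_(j < n) c j * b j x &
      forall c : 'I_n -> R,
        (forall x, A x -> \sum_(j < n) c j * b j x = 0) -> forall j, c j = 0].

(* trace on the boundary, from inside Omega, of the gradient of psi; for a
   piecewise polynomial psi the limit exists in the interior of each facet *)
Definition grad_trace Omega (psi : 'rV[R]_d -> R) (x : 'rV[R]_d) : 'rV[R]_d :=
  lim (grad psi y @[y --> within Omega (nbhs x)]).

End FiniteElements.

Section Matrices.
Context {R : realType} {d : nat}.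
Variables (Omegap Omegam : set 'rV[R]_d) (Tm : set (set 'rV[R]_d)).
Variables (kp km alpha : R) (nu : 'rV[R]_d -> 'rV[R]_d).
Variables (np nm : nat).
Variables (phi : 'I_np -> 'rV[R]_d -> R) (psi : 'I_nm -> 'rV[R]_d -> R).

Definition interface : set 'rV[R]_d := bdry Omegam `\` bdry Omegap.

Definition mat_Kp : 'M[R]_np := \matrix_(i, j)
  vol_integral Omegap (fun x => kp * dot (grad (phi j) x) (grad (phi i) x)).

Definition mat_S : 'M[R]_(np, nm) := \matrix_(i, j)
  - \sum_(e \in induced_partition Omegam Tm interface)
      surf_integral e (fun x =>
        (kp - km) * dot (grad_trace Omegam (psi j) x) (nu x) * phi i x).

Definition mat_D : 'M[R]_(nm, np) := \matrix_(i, j)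
  - (alpha * surf_integral interface (fun x => phi j x * psi i x)).

Definition mat_Km : 'M[R]_nm := \matrix_(i, j)
  (vol_integral Omegam (fun x => km * dot (grad (psi j) x) (grad (psi i) x))
   + alpha * surf_integral interface (fun x => psi j x * psi i x)).

End Matrices.

Section LinearAlgebra.
Context {R : realType}.

(* largest modulus of a complex eigenvalue; 0 for the empty matrix *)
Definition spectral_radius (n : nat) (M : 'M[R]_n) : R :=
  sup [set r | exists2 lam : R[i],
         eigenvalue (map_mx (real_complex R) M) lam & r = Normc.normc lam].

Variables (np nm : nat).
Variables (Kp : 'M[R]_np) (S : 'M[R]_(np, nm)).
Variables (D : 'M[R]_(nm, np)) (Km : 'M[R]_nm).
Variables (fp : 'cV[R]_np) (fm : 'cV[R]_nm).

Definition solves_coupled (Tp : 'cV[R]_np) (Tm : 'cV[R]_nm) : Prop :=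
  block_mx Kp S D Km *m col_mx Tp Tm = col_mx fp fm.

(* Tm 0 is unconstrained: the scheme only needs Tp 0. *)
Definition coupled_iteration (Tp0 : 'cV[R]_np)
    (Tp : nat -> 'cV[R]_np) (Tm : nat -> 'cV[R]_nm) : Prop :=
  Tp 0%N = Tp0 /\
  forall k, Km *m Tm k.+1 = fm - D *m Tp k /\
            Kp *m Tp k.+1 = fp - S *m Tm k.+1.

End LinearAlgebra.

(* Main.v *)
Require Import Defs.
From HB Require Import structures.
From mathcomp Require Import all_boot all_order all_algebra.
From mathcomp Require Import all_classical all_reals all_analysis.
From mathcomp Require Import complex.

Set Implicit Arguments.
Unset Strict Implicit.
Unset Printing Implicit Defensive.

Import Order.TTheory GRing.Theory Num.Theory.
Import numFieldNormedType.Exports.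

Local Open Scope classical_set_scope.
Local Open Scope ring_scope.

(* Eliminating the local unknown, the scheme reads x_(k+1) = M x_k + g with
   M = Kp^-1 S Km^-1 D, which unrolls to the stated formula.  If rho(M) < 1,
   factor the characteristic polynomial of M over R[i] and use Cayley-Hamilton:
   removing one root at a time reduces M^k v --> 0 to the scalar recurrence
   a_(k+1) <= r a_k + b_k with r < 1 and b_k --> 0.  In particular M has no
   nonzero fixed vector, so 1 - M is invertible, x = M x + g has a unique
   solution, and the error is M^k applied to the initial error. *)

(** Beyond an index [N] with |b_k| < (e/2)(1 - r), the bound r^j a_N + e/2 propagates by induction,
    since e/2 is the fixed point of t |-> r t + (e/2)(1 - r). *)
Lemma contraction_cvg0 (R : realType) (r : R) (a b : R^nat) :
  0 <= r < 1 -> (forall k, 0 <= a k) ->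
  (forall k, a k.+1 <= r * a k + b k) ->
  b k @[k --> \oo] --> 0 -> a k @[k --> \oo] --> 0.
Proof.
move=> /andP[r0 r1] a0 ab b0; apply/cvgr0Pnorm_lt => e e0.
have e2 : 0 < e / 2 by rewrite divr_gt0.
have r1' : 0 < 1 - r by rewrite subr_gt0.
have /cvgr0Pnorm_lt/(_ _ (mulr_gt0 e2 r1'))[N _ Nb] := b0.
have aN j : a (N + j)%N <= r ^+ j * a N + e / 2.
  elim: j => [|j IHj].
    by rewrite addn0 expr0 mul1r lerDl ltW.
  rewrite addnS; apply: le_trans (ab _) _.
  have /ltW bj : b (N + j)%N < e / 2 * (1 - r).
    by apply: le_lt_trans (ler_norm _) (Nb _ _); rewrite /= leq_addr.
  apply: le_trans (lerD (ler_wpM2l r0 IHj) bj) _.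
  rewrite mulrDr mulrA -exprS -addrA lerD2l.
  by rewrite mulrBr mulr1 [r * _]mulrC addrC subrK.
have /cvgr0Pnorm_lt/(_ _ e2)[K _ Kr] : r ^+ j * a N @[j --> \oo] --> 0.
  rewrite -(mul0r (a N)); apply: cvgMr_tmp.
  by apply: cvg_expr; rewrite ger0_norm.
exists (N + K)%N => // n /= NKn.
rewrite ger0_norm// -(subnKC (leq_trans (leq_addr _ _) NKn)).
apply: le_lt_trans (aN _) _; rewrite [ltRHS](splitr e) ltrD2r.
apply: le_lt_trans (ler_norm _) (Kr _ _).
by rewrite /= leq_subRL// (leq_trans (leq_addr _ _) NKn).
Qed.

(** A neighbourhood of [L] contains a product of entrywise neighbourhoods, and finitely many
    eventual conditions hold together eventually. *)
Lemma cvg_mx (T : topologicalType) (I : Type) (F : set_system I)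
    {FF : Filter F} (m n : nat) (f : I -> 'M[T]_(m, n)) (L : 'M[T]_(m, n)) :
  (forall i j, f x i j @[x --> F] --> L i j) -> f x @[x --> F] --> L.
Proof.
move=> fL A [P LP PA].
suff : \forall x \near F, forall i j, P i j (f x i j).
  by apply: filterS => x; exact: PA.
by apply: filter_forall => i; apply: filter_forall => j; exact: fL (LP i j).
Qed.

Lemma mulmxl_continuous (K : numFieldType) (m n p : nat) (A : 'M[K]_(m, n)) :
  continuous (fun B : 'M[K]_(n, p) => A *m B).
Proof.
move=> B; apply: (cvg_mx (F := nbhs B)) => i j; rewrite mxE.
under eq_fun do rewrite mxE.
apply: cvg_big => [|l _]; first exact: add_continuous.
by apply: cvgMl_tmp; exact: coord_continuous.
Qed.

Lemma normc_ge0 (R : rcfType) (x : R[i]) : 0 <= Normc.normc x.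
Proof. by case: x => x y; exact: sqrtr_ge0. Qed.

(* Peeling off a root z: if u = (A - z) v, then A^(k+1) v = z A^k v + A^k u,
   where A^k u tends to 0 by induction. *)
Lemma horner_prod_roots_cvg0 (R : realType) (n : nat) (A : 'M[R[i]]_n.+1)
    (s : seq R[i]) (v : 'cV[R[i]]_n.+1) :
  all (fun z => Normc.normc z < 1) s ->
  horner_mx A (\prod_(z <- s) ('X - z%:P)) *m v = 0 ->
  forall i, Normc.normc ((A ^+ k *m v) i 0) @[k --> \oo] --> (0 : R).
Proof.
elim: s v => [|z s IHs] v /=.
  rewrite big_nil rmorph1 mul1mx => _ -> i.
  under eq_fun do rewrite mulmx0 mxE Normc.normc0.
  exact: cvg_cst.
(* Commuting the factors lets [A - z] act on [v] first, so that the remaining factors annihilate (A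
   - z) v. *)
move=> /andP[z1 s1]; rewrite big_cons mulrC rmorphM /= -mulmxA => Av i.
rewrite rmorphB/= horner_mx_X horner_mx_C in Av.
apply: (contraction_cvg0 _ _ _ (IHs _ s1 Av i)) => [|k|k].
- by apply/andP; split; first exact: normc_ge0.
- exact: normc_ge0.
- rewrite -Normc.normcM.
  have -> : A ^+ k.+1 *m v =
      z *: (A ^+ k *m v) + A ^+ k *m ((A - z%:M) *m v).
    rewrite mulmxBl mul_scalar_mx mulmxBr -scalemxAr mulmxA.
    by rewrite -[A ^+ k *m A]/(A ^+ k * A) -exprSr addrC subrK.
  rewrite [X in Normc.normc X]mxE [X in Normc.normc (X + _)]mxE.
  exact: le_normcD.
Qed.

(** A [sup] dominates its set only if the set is bounded above; here the sum of the moduli of all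
    characteristic roots is a bound. *)
Lemma eigenvalue_le_spectral_radius (R : realType) (n : nat) (M : 'M[R]_n)
    (z : R[i]) :
  eigenvalue (map_mx (real_complex R) M) z ->
  Normc.normc z <= spectral_radius M.
Proof.
move=> zM; apply: sup_upper_bound; last by exists z.
split; first by exists (Normc.normc z), z.
set p := char_poly (map_mx (real_complex R) M).
have [s ps] := closed_field_poly_normal p.
exists (\sum_(w <- s) Normc.normc w) => _ [w wM ->].
have ws : w \in s.
  move: wM; rewrite eigenvalue_root_char -/p ps.
  by rewrite (monicP (char_poly_monic _)) scale1r root_prod_XsubC.
by rewrite (big_rem w)//= lerDl sumr_ge0// => x _; exact: normc_ge0.
Qed.

Lemma spectral_radius_lt1_cvg0 (R : realType) (n : nat) (M : 'M[R]_n)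
    (v : 'cV[R]_n) :
  spectral_radius M < 1 -> M ^+ k *m v @[k --> \oo] --> (0 : 'cV[R]_n).
Proof.
(* The root-peeling lemma needs positive size; in size 0 there is no entry to check. *)
case: n M v => [|n] M v rM; apply: cvg_mx => i j; first by case: i.
pose f := real_complex R; pose A := map_mx f M.
have [s As] := closed_field_poly_normal (char_poly A).
rewrite (monicP (char_poly_monic _)) scale1r in As.
have s1 : all (fun z => Normc.normc z < 1) s.
  apply/allP => z zs; apply: le_lt_trans rM.
  apply: eigenvalue_le_spectral_radius.
  by rewrite eigenvalue_root_char -/A As root_prod_XsubC.
have Av0 : horner_mx A (\prod_(z <- s) ('X - z%:P)) *m map_mx f v = 0.
  by rewrite -As Cayley_Hamilton mul0mx.
have := horner_prod_roots_cvg0 s1 Av0 i.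
rewrite ord1 mxE => Avi; apply/norm_cvg0P; apply: cvg_trans Avi.
apply: near_eq_cvg; near=> k.
(* The entries of A^k v are images of reals, so their complex modulus is the real absolute value. *)
rewrite -rmorphXn/= -map_mxM mxE/= expr0n/= addr0.
by rewrite sqrtr_sqr.
Unshelve. all: by end_near. Qed.

Lemma affine_iterE (R : comPzRingType) (n : nat) (M : 'M[R]_n) (g : 'cV[R]_n)
    (X : nat -> 'cV[R]_n) :
  (forall k, X k.+1 = M *m X k + g) ->
  forall k, X k = (\sum_(0 <= j < k) M ^+ j) *m g + M ^+ k *m X 0%N.
Proof.
move=> XS; elim=> [|k IHk].
  by rewrite big_nil expr0 mul0mx add0r mul1mx.
have MS m : M ^+ m.+1 = M *m M ^+ m by rewrite exprS.
(* The term j = 0 accounts for the added [g]; the shifted terms are [M] times the previous sum. *)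
rewrite XS IHk big_nat_recl// expr0 mulmxDl mul1mx mulmxDr !mulmxA -MS.
under [in RHS]eq_bigr do rewrite MS.
by rewrite -mulmx_sumr [LHS]addrC addrA.
Qed.

Lemma spectral_radius_lt1_unitmx (R : realType) (n : nat) (M : 'M[R]_n) :
  spectral_radius M < 1 -> 1%:M - M \in unitmx.
Proof.
(* Row freeness concerns the left kernel; transposing turns its elements into column vectors fixed
   by [M]. The constant sequence M^k v = v then tends to 0. *)
move=> rM; rewrite -unitmx_tr -row_free_unit; apply: inj_row_free => v.
move=> /(congr1 trmx); rewrite trmx_mul trmxK trmx0.
rewrite mulmxBl mul1mx => /subr0_eq vM.
have Mkv k : M ^+ k *m v^T = v^T.
  elim: k => [|k IHk]; first by rewrite expr0 mul1mx.
  by rewrite exprS -[M * _]/(M *m _) -mulmxA IHk -vM.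
have := spectral_radius_lt1_cvg0 v^T rM.
under eq_fun do rewrite Mkv.
move=> /(cvg_lim (@norm_hausdorff _ _)).
rewrite (lim_cst (@norm_hausdorff _ _)) => v0.
by rewrite -[v]trmxK v0 trmx0.
Qed.

Lemma affine_iter_cvg (R : realType) (n : nat) (M : 'M[R]_n) (g Y : 'cV[R]_n)
    (X : nat -> 'cV[R]_n) :
  spectral_radius M < 1 -> Y = M *m Y + g ->
  (forall k, X k.+1 = M *m X k + g) -> X k @[k --> \oo] --> Y.
Proof.
move=> rM YE XS.
have -> : X = fun k => Y + M ^+ k *m (X 0%N - Y).
  apply/funext; elim => [|k IHk].
    by rewrite expr0 mul1mx addrC subrK.
  rewrite XS IHk exprS -[M * _]/(M *m _) mulmxDr -mulmxA addrAC.
  by rewrite -YE.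
rewrite -[X in _ --> X]addr0.
by apply: cvgD; [exact: cvg_cst|exact: spectral_radius_lt1_cvg0].
Qed.

Lemma mulmx_invmx_eq (R : comUnitRingType) (n : nat) (K : 'M[R]_n)
    (x y : 'cV[R]_n) :
  K \in unitmx -> K *m x = y <-> x = invmx K *m y.
Proof.
by move=> Ku; split=> [<-|->]; [rewrite mulKmx|rewrite mulKVmx].
Qed.

(** Keeping [x'] distinct from [x] lets one equivalence serve both the iteration step and, with x' =
    x, the coupled system. *)
Lemma gauss_seidel_eliminate (R : comUnitRingType) (np nm : nat)
    (Kp : 'M[R]_np) (S : 'M[R]_(np, nm)) (D : 'M[R]_(nm, np)) (Km : 'M[R]_nm)
    (fp : 'cV[R]_np) (fm : 'cV[R]_nm) (x x' : 'cV[R]_np) (y : 'cV[R]_nm) :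
  Kp \in unitmx -> y = invmx Km *m (fm - D *m x) ->
  Kp *m x' = fp - S *m y <->
  x' = invmx Kp *m S *m invmx Km *m D *m x +
       invmx Kp *m (fp - S *m invmx Km *m fm).
Proof.
move=> Kpu ->; rewrite mulmx_invmx_eq// !mulmxBr !mulmxA opprB.
by rewrite [in X in _ <-> X]addrC -addrA [_ + - _]addrC.
Qed.

Lemma solves_coupledE (R : realType) (np nm : nat) (Kp : 'M[R]_np)
    (S : 'M[R]_(np, nm)) (D : 'M[R]_(nm, np)) (Km : 'M[R]_nm)
    (fp : 'cV[R]_np) (fm : 'cV[R]_nm) (x : 'cV[R]_np) (y : 'cV[R]_nm) :
  solves_coupled Kp S D Km fp fm x y <->
  Km *m y = fm - D *m x /\ Kp *m x = fp - S *m y.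
Proof.
rewrite /solves_coupled mul_block_col; split.
  by move=> /eq_col_mx[<- <-]; rewrite addrK addrC addKr.
by move=> [Ey Ex]; rewrite Ex Ey subrK addrC subrK.
Qed.

Theorem proposition1 (R : realType) (d : nat) (hd : d = 2%N \/ d = 3%N)
  (* domains and boundaries *)
  (Omegap Omegam GammaD GammaN : set 'rV[R]_d)
  (hOmegap : lipschitz_domain Omegap)
  (hOmegam : lipschitz_domain Omegam)
  (hsub : Omegam `<=` Omegap)
  (hGammaD : GammaD `<=` bdry Omegap)
  (hGammaD_pos : (0 < surface_measure GammaD)%E)
  (hGammaN : GammaN `<=` bdry Omegap)
  (hinterface_pos : (0 < surface_measure (interface Omegap Omegam))%E)
  (* outward unit normal to Omegam, almost everywhere on the interface *)
  (nu : 'rV[R]_d -> 'rV[R]_d)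
  (hnu : surface_measure (interface Omegap Omegam `&`
           [set x | ~ outward_unit_normal Omegam x (nu x)]) = 0%E)
  (* physical constants and penalization parameter *)
  (kp km alpha : R) (hkp : 0 < kp) (hkm : 0 < km) (halpha : 0 < alpha)
  (* meshes, finite element spaces and bases *)
  (meshp meshm : set (set 'rV[R]_d))
  (hmeshp : is_mesh Omegap meshp)
  (hmeshm : is_mesh Omegam meshm)
  (locp locm : set 'rV[R]_d -> set ('rV[R]_d -> R))
  (hlocp : forall K, meshp K -> local_polynomial_space (locp K))
  (hlocm : forall K, meshm K -> local_polynomial_space (locm K))
  (np nm : nat)
  (phi : 'I_np -> 'rV[R]_d -> R) (psi : 'I_nm -> 'rV[R]_d -> R)
  (hphi : basis_on (closure Omegap)
            [set v | fe_space Omegap meshp locp v /\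
                     forall x, GammaD x -> v x = 0] phi)
  (hpsi : basis_on (closure Omegam)
            [set w | fe_space Omegam meshm locm w /\
                     forall x, (GammaD `&` bdry Omegam) x -> w x = 0] psi) :
  let Kp := mat_Kp Omegap kp phi in
  let S := mat_S Omegap Omegam meshm kp km nu phi psi in
  let D := mat_D Omegap Omegam alpha phi psi in
  let Km := mat_Km Omegap Omegam km alpha psi in
  let M := invmx Kp *m S *m invmx Km *m D in
  Kp \in unitmx -> Km \in unitmx ->
  forall (fp : 'cV[R]_np) (fm : 'cV[R]_nm) (Tp0 : 'cV[R]_np)
    (Tp : nat -> 'cV[R]_np) (Tm : nat -> 'cV[R]_nm),
  coupled_iteration Kp S D Km fp fm Tp0 Tp Tm ->
  (forall k : nat, (1 <= k)%N ->
     Tp k = (\sum_(0 <= j < k) M ^+ j) *m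
              (invmx Kp *m (fp - S *m invmx Km *m fm))
            + M ^+ k *m Tp0) /\
  (spectral_radius M < 1 ->
     exists (Tps : 'cV[R]_np) (Tms : 'cV[R]_nm),
       [/\ solves_coupled Kp S D Km fp fm Tps Tms,
           forall Up Um, solves_coupled Kp S D Km fp fm Up Um ->
             Up = Tps /\ Um = Tms,
           Tp k @[k --> \oo] --> Tps &
           Tm k @[k --> \oo] --> Tms]).
Proof.
move=> Kp S D Km M Kpu Kmu fp fm Tp0 Tp Tm [Tp0E TS].
pose g := invmx Kp *m (fp - S *m invmx Km *m fm).
have TmS k : Tm k.+1 = invmx Km *m (fm - D *m Tp k).
  by apply/mulmx_invmx_eq => //; have [] := TS k.
have TpS k : Tp k.+1 = M *m Tp k + g.
  by have [_ /(gauss_seidel_eliminate S fp _ Kpu (TmS k))] := TS k.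
split=> [k _|rM]; first by rewrite (affine_iterE TpS) Tp0E.
have solE x y : solves_coupled Kp S D Km fp fm x y <->
    y = invmx Km *m (fm - D *m x) /\ x = M *m x + g.
  rewrite solves_coupledE mulmx_invmx_eq//.
  by split=> -[yE /(gauss_seidel_eliminate S fp _ Kpu yE)].
(* Rewriting the fixed-point equation as (1 - M) x = g yields existence and uniqueness at once. *)
have fixE x : x = M *m x + g <-> x = invmx (1%:M - M) *m g.
  rewrite -mulmx_invmx_eq ?spectral_radius_lt1_unitmx// mulmxBl mul1mx.
  split=> [xE|<-]; first by rewrite {1}xE addrC addKr.
  by rewrite addrC subrK.
pose Tps := invmx (1%:M - M) *m g.
have TpsE : Tps = M *m Tps + g by apply/fixE.
have Tp_cvg := affine_iter_cvg rM TpsE TpS.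
exists Tps, (invmx Km *m (fm - D *m Tps)); split=> //.
- exact/solE.
- by move=> Up Um /solE[-> /fixE ->].
(* [Tm 0] is arbitrary, so the shifted sequence is used: it is a continuous affine image of [Tp]. *)
- rewrite -cvg_shiftS; under eq_fun do rewrite TmS.
  have fmD : fm - D *m Tp k @[k --> \oo] --> fm - D *m Tps.
    apply: cvgB; first exact: cvg_cst.
    exact: (cvg_comp _ _ Tp_cvg (@mulmxl_continuous _ _ _ _ D _)).
  exact: (cvg_comp _ _ fmD (@mulmxl_continuous _ _ _ _ (invmx Km) _)).
Qed.
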